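(* Let $\tau$ be an embedding-continuous structure. If $\tau$ admits a stable element-rooted metrization $\tau^{\mathrm{erm}}$ with distortion $\Theta_{\tau^{\mathrm{erm}}}$, then for all $\mathcal{X},\mathcal{Y}\in\mathfrak{M}_\bullet(\tau)$, $$\check d_{\mathfrak{M}_\bullet}^{\tau^{\mathrm{erm}}}(\mathcal{X},\mathcal{Y})\le d_{\mathfrak{M}_\bullet}^{\tau^{\mathrm{erm}}}(\mathcal{X},\mathcal{Y})\le 2\,\check d_{\mathfrak{M}_\bullet}^{\tau^{\mathrm{erm}}}(\mathcal{X},\mathcal{Y})+\Theta_{\tau^{\mathrm{erm}}}\bigl(2\,\check d_{\mathfrak{M}_\bullet}^{\tau^{\mathrm{erm}}}(\mathcal{X},\mathcal{Y})\bigr).$$ If $\tau$ admits a stable metrization $\tau^{\mathrm{m}}$ with distortion $\Theta_{\tau^{\mathrm m}}$, then the same inequalities hold with $\tau^{\mathrm{erm}}$ replaced by $\tau^{\mathrm{m}}$ throughout.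
   Context: A bcm (boundedly-compact metric) space is a non-empty metric space in which every closed ball of finite radius is compact; a rooted bcm space $(X,\rho_X)$ is a bcm space $X$ with a distinguished point $\rho_X$. The metric of $X$ is denoted $d_X$, and $D_X(x,r)=\{y: d_X(x,y)\le r\}$. An isometric embedding is a distance-preserving map (not necessarily onto); an isometry is a bijective one; a map is root-preserving if it sends root to root. A topological embedding is a homeomorphism onto its image. Structure: a functor $\tau$ from the category of bcm spaces (morphisms: isometric embeddings) to the category of metrizable topological spaces (morphisms: topological embeddings). That is, to each bcm space $X$ it assigns a metrizable space $\tau(X)$ and to each isometric embedding $f\colon X\to Y$ a topological embedding $\tau_f\colon\tau(X)\to\tau(Y)$, with $\tau_{\mathrm{id}_X}=\mathrm{id}_{\tau(X)}$ and $\tau_{g\circ f}=\tau_g\circ\tau_f$. $\tau$ is embedding-continuous if, whenever $X,Y$ are bcm spaces and $f_n\colon X\to Y$, $n\in\mathbb{N}\cup\{\infty\}$, are isometric embeddings with $f_n\to f_\infty$ uniformly on compact sets, one has $\tau_{f_n}(a)\to\tau_{f_\infty}(a)$ in $\tau(Y)$ for all $a\in\tau(X)$. $\mathfrak{M}_\bullet(\tau)$: the set of (representatives of) equivalence classes of triples $(X,\rho_X,a_X)$, with $(X,\rho_X)$ a rooted bcm space and $a_X\in\tau(X)$, where $(X,\rho_X,a_X)\sim(Y,\rho_Y,a_Y)$ iff there is a root-preserving isometry $f\colon X\to Y$ with $\tau_f(a_X)=a_Y$. Metrization $\tau^{\mathrm m}$: a choice, for each bcm space $X$, of a metric $d^{\tau^{\mathrm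 m}}_X$ on $\tau(X)$ inducing its topology such that $\tau_f$ is distance-preserving for every isometric embedding $f$. Element-rooted metrization $\tau^{\mathrm{erm}}$: a choice, for each bcm space $X$, of a metric $d^{\tau^{\mathrm{erm}}}_{X}$ on $\tau(X)\times X$ inducing the product topology such that $\tau_f\times f$ is distance-preserving for every isometric embedding $f\colon X\to Y$. So both are functors from bcm spaces to metric spaces (with isometric embeddings). Stability: a functor $\sigma$ from bcm spaces to metric spaces (morphisms: isometric embeddings; $d^\sigma_X$ the metric of $\sigma(X)$) is stable with distortion $\Theta_\sigma\colon[0,\infty)\to[0,\infty)$ if $\lim_{\varepsilon\to0}\Theta_\sigma(\varepsilon)=\Theta_\sigma(0)=0$ and the following holds: for all bcm spaces $X,Y,M_1,M_2$, isometric embeddings $f_i\colon X\to M_i$, $g_i\colon Y\to M_i$ ($i=1,2$) and $\varepsilon\ge 0$ such that $d_{M_2}(f_2(x),g_2(y))\le d_{M_1}(f_1(x),g_1(y))+\varepsilon$ for all $x\in X,y\in Y$, one has $d^\sigma_{M_2}(\sigma_{f_2}(a),\sigma_{g_2}(b))\le d^\sigma_{M_1}(\sigma_{f_1}(a),\sigma_{g_1}(b))+\Theta_\sigma(\varepsilon)$ for all $a\in\sigma(X)$, $b\in\sigma(Y)$. Hausdorff metric on compact subsets (including $\emptyset$) of a metric space $M$: $d^H_M(A,B)=\inf\{\varepsilon\ge0: A\subseteq B^\varepsilon, B\subseteq A^\varepsilon\}$, where $A^\varepsilon=\{x:\exists y\in A, d_M(x,y)\le\varepsilon\}$ and $\inf\emptyset=\infty$.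 For a bcm space $M$, closed $A,B\subseteq M$ and $x,y\in M$, $$d^F_{M}((A,x),(B,y))=d_M(x,y)\vee\int_0^\infty e^{-r}\bigl(1\wedge d^H_M(A\cap D_M(x,r),B\cap D_M(y,r))\bigr)dr,$$ and $d^F_{M,\rho}(A,B)=d^F_M((A,\rho),(B,\rho))$. Distances, for $\mathcal{X}=(X,\rho_X,a_X)$, $\mathcal{Y}=(Y,\rho_Y,a_Y)$ in $\mathfrak{M}_\bullet(\tau)$: $$\check d_{\mathfrak{M}_\bullet}^{\tau^{\mathrm{erm}}}(\mathcal{X},\mathcal{Y})=\inf_{f,g,Z}\bigl\{d^F_{Z}\bigl((f(X),f(\rho_X)),(g(Y),g(\rho_Y))\bigr)\vee d^{\tau^{\mathrm{erm}}}_{Z}\bigl((\tau_f(a_X),f(\rho_X)),(\tau_g(a_Y),g(\rho_Y))\bigr)\bigr\},$$ over all bcm spaces $Z$ and isometric embeddings $f\colon X\to Z$, $g\colon Y\to Z$; $$d_{\mathfrak{M}_\bullet}^{\tau^{\mathrm{erm}}}(\mathcal{X},\mathcal{Y})=\inf_{f,g,Z}\bigl\{d^F_{Z,\rho_Z}(f(X),g(Y))\vee d^{\tau^{\mathrm{erm}}}_{Z}\bigl((\tau_f(a_X),\rho_Z),(\tau_g(a_Y),\rho_Z)\bigr)\bigr\},$$ over all rooted bcm spaces $(Z,\rho_Z)$ and root-preserving isometric embeddings $f\colon X\to Z$, $g\colon Y\to Z$. For a metrization $\tau^{\mathrm m}$, $\check d_{\mathfrak{M}_\bullet}^{\tau^{\mathrm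 m}}$ and $d_{\mathfrak{M}_\bullet}^{\tau^{\mathrm m}}$ are these quantities for the associated element-rooted metrization $((a,x),(b,y))\mapsto d^{\tau^{\mathrm m}}_X(a,b)\vee d_X(x,y)$. *)

(* Defs.v *)
From HB Require Import structures.
From mathcomp Require Import all_boot all_order all_algebra.
From mathcomp Require Import all_classical all_reals all_analysis.

Set Implicit Arguments.
Unset Strict Implicit.
Unset Printing Implicit Defensive.

Import Order.TTheory GRing.Theory Num.Theory.
Import numFieldNormedType.Exports.

Local Open Scope classical_set_scope.
Local Open Scope ring_scope.

Definition cball (R : realType) (M : metricType R) (x : M) (r : R) : set M :=
  [set y | mdist x y <= r].

Record bcm (R : realType) := Bcm {
  bcm_space :> metricType R;
  bcm_nonempty : [set: bcm_space] !=set0;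
  bcm_compact : forall (x : bcm_space) (r : R), compact (cball x r)
}.

Record rooted_bcm (R : realType) := RootedBcm {
  rooted_space :> bcm R;
  root_pt : rooted_space
}.

Record isometric_embedding (R : realType) (A B : metricType R) := IsoEmb {
  iemb_fun :> A -> B;
  iembP : forall x y, mdist (iemb_fun x) (iemb_fun y) = mdist x y
}.

Definition iemb_id (R : realType) (A : metricType R) :
    isometric_embedding A A :=
  IsoEmb (fun x y : A => erefl (mdist x y)).

Definition iemb_comp (R : realType) (A B C : metricType R)
    (g : isometric_embedding B C) (f : isometric_embedding A B) :
    isometric_embedding A C :=
  IsoEmb (fun x y => etrans (iembP g (f x) (f y)) (iembP f x y)).

(* Injective, continuous, and open onto the image with its subspace
   topology. The domain may be empty. *)
Definition topological_embedding (S T : topologicalType) (f : S -> T) :=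
  [/\ injective f, continuous f &
    forall U : set S, open U -> exists2 V, open V & f @` U = V `&` range f].

Record metric_on (R : realType) (T : Type) := MetricOn {
  metric_fun :> T -> T -> R;
  metric_funxx : forall x, metric_fun x x = 0;
  metric_fun_eq0 : forall x y, metric_fun x y = 0 -> x = y;
  metric_fun_sym : forall x y, metric_fun x y = metric_fun y x;
  metric_fun_triangle :
    forall y x z, metric_fun x z <= metric_fun x y + metric_fun y z
}.

(* [metrized d] is an alias of T that carries the metric d, and the
   topology of d instead of the topology of T. *)
Definition metrized (R : realType) (T : topologicalType) (d : metric_on R T) :
  Type := T.

HB.instance Definition _ (R : realType) (T : topologicalType)
  (d : metric_on R T) := Choice.on (metrized d).
HB.instance Definition _ (R : realType) (T : topologicalType)
  (d : metric_on R T) := @isMetric.Build R (metrized d) d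
    (metric_funxx d) (@metric_fun_eq0 _ _ d) (metric_fun_sym d)
    (metric_fun_triangle d).

Definition induces_topology (R : realType) (T : topologicalType)
    (d : metric_on R T) :=
  forall A : set T, @open T A <-> @open (metrized d) A.

Definition metrizable (R : realType) (T : topologicalType) :=
  exists d : metric_on R T, induces_topology d.

Record structure (R : realType) := Structure {
  st_obj :> bcm R -> topologicalType;
  st_map : forall X Y : bcm R, isometric_embedding X Y -> st_obj X -> st_obj Y;
  st_metrizable : forall X, metrizable R (st_obj X);
  st_embedding : forall (X Y : bcm R) (f : isometric_embedding X Y),
    topological_embedding (st_map f);
  st_map_id : forall (X : bcm R) (a : st_obj X), st_map (iemb_id X) a = a;
  st_map_comp : forall (X Y Z : bcm R) (g : isometric_embedding Y Z)
    (f : isometric_embedding X Y) (a : st_obj X),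
    st_map (iemb_comp g f) a = st_map g (st_map f a)
}.
Arguments st_map {R} s {X Y} f a.

Definition embedding_continuous (R : realType) (tau : structure R) :=
  forall (X Y : bcm R) (f : nat -> isometric_embedding X Y)
    (g : isometric_embedding X Y),
  {family compact, (fun n => f n : X -> Y) @ \oo --> (g : X -> Y)} ->
  forall a : tau X, st_map tau (f n) a @[n --> \oo] --> st_map tau g a.

Record metric_functor (R : realType) := MetricFunctor {
  mf_obj :> bcm R -> metricType R;
  mf_map : forall X Y : bcm R, isometric_embedding X Y ->
    isometric_embedding (mf_obj X) (mf_obj Y);
  mf_map_id : forall (X : bcm R) (a : mf_obj X), mf_map (iemb_id X) a = a;
  mf_map_comp : forall (X Y Z : bcm R) (g : isometric_embedding Y Z)
    (f : isometric_embedding X Y) (a : mf_obj X),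
    mf_map (iemb_comp g f) a = mf_map g (mf_map f a)
}.
Arguments mf_map {R} m {X Y} f.

(* Theta stands for a function on [0, +oo[: its values at negative numbers
   are irrelevant, and the limit at 0 is a limit from the right. *)
Definition stable (R : realType) (sigma : metric_functor R) (Theta : R -> R) :=
  [/\ forall e : R, 0 <= e -> 0 <= Theta e,
      Theta e @[e --> 0^'+] --> (0 : R),
      Theta 0 = 0 &
      forall (X Y M1 M2 : bcm R)
        (f1 : isometric_embedding X M1) (f2 : isometric_embedding X M2)
        (g1 : isometric_embedding Y M1) (g2 : isometric_embedding Y M2)
        (e : R), 0 <= e ->
      (forall x y, mdist (f2 x) (g2 y) <= mdist (f1 x) (g1 y) + e) ->
      forall (a : sigma X) (b : sigma Y),
        mdist (mf_map sigma f2 a) (mf_map sigma g2 b) <=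
        mdist (mf_map sigma f1 a) (mf_map sigma g1 b) + Theta e].

Record metrization (R : realType) (tau : structure R) := Metrization {
  mz_metric :> forall X : bcm R, metric_on R (tau X);
  mz_induces : forall X : bcm R, induces_topology (mz_metric X);
  mz_isometric : forall (X Y : bcm R) (f : isometric_embedding X Y)
    (a b : tau X),
    mz_metric Y (st_map tau f a) (st_map tau f b) = mz_metric X a b
}.

Definition st_map_prod (R : realType) (tau : structure R) (X Y : bcm R)
    (f : isometric_embedding X Y) (p : tau X * X) : tau Y * Y :=
  (st_map tau f p.1, f p.2).

Record er_metrization (R : realType) (tau : structure R) := ErMetrization {
  erm_metric :> forall X : bcm R, metric_on R (tau X * X)%type;
  erm_induces : forall X : bcm R, induces_topology (erm_metric X);
  erm_isometric : forall (X Y : bcm R) (f : isometric_embedding X Y)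
    (p q : tau X * X),
    erm_metric Y (st_map_prod f p) (st_map_prod f q) = erm_metric X p q
}.

Definition metrization_functor (R : realType) (tau : structure R)
    (m : metrization tau) : metric_functor R :=
  @MetricFunctor R (fun X => metrized (m X))
    (fun X Y f => @IsoEmb R (metrized (m X)) (metrized (m Y))
                    (st_map tau f) (mz_isometric m f))
    (@st_map_id R tau) (@st_map_comp R tau).

Lemma st_map_prod_id (R : realType) (tau : structure R) (X : bcm R)
  (p : tau X * X) : st_map_prod (iemb_id X) p = p.
Proof. by case: p => a x; rewrite /st_map_prod st_map_id. Qed.

Lemma st_map_prod_comp (R : realType) (tau : structure R) (X Y Z : bcm R)
  (g : isometric_embedding Y Z) (f : isometric_embedding X Y)
  (p : tau X * X) :
  st_map_prod (iemb_comp g f) p = st_map_prod g (st_map_prod f p).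
Proof. by rewrite /st_map_prod st_map_comp. Qed.

Definition er_metrization_functor (R : realType) (tau : structure R)
    (e : er_metrization tau) : metric_functor R :=
  @MetricFunctor R (fun X => metrized (e X))
    (fun X Y f => @IsoEmb R (metrized (e X)) (metrized (e Y))
                    (st_map_prod f) (erm_isometric e f))
    (@st_map_prod_id R tau) (@st_map_prod_comp R tau).

Section MaxMetric.
Context (R : realType) (T : topologicalType) (M : metricType R)
  (d : metric_on R T).

Definition max_dist (p q : T * M) : R :=
  Num.max (d p.1 q.1) (mdist p.2 q.2).

Lemma max_distxx p : max_dist p p = 0.
Proof. by rewrite /max_dist metric_funxx mdistxx maxxx. Qed.

Lemma metric_fun_ge0 x y : 0 <= d x y.
Proof. exact: (@mdist_ge0 R (metrized d) x y). Qed.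

Lemma max_dist_eq0 p q : max_dist p q = 0 -> p = q.
Proof.
case: p q => [a x] [b y]; rewrite /max_dist /= => h.
congr pair.
- apply: (@metric_fun_eq0 _ _ d); apply/eqP; rewrite eq_le metric_fun_ge0 andbT.
  by rewrite -h le_max lexx.
- apply: mdist_positivity; apply/eqP; rewrite eq_le mdist_ge0 andbT.
  by rewrite -h le_max lexx orbT.
Qed.

Lemma max_dist_sym p q : max_dist p q = max_dist q p.
Proof. by rewrite /max_dist metric_fun_sym metric_sym. Qed.

Lemma max_dist_triangle q p r : max_dist p r <= max_dist p q + max_dist q r.
Proof.
rewrite /max_dist ge_max; apply/andP; split.
- by rewrite (le_trans (metric_fun_triangle d q.1 _ _))// lerD// le_max lexx.
- by rewrite (le_trans (metric_triangle _ q.2 _))// lerD// le_max lexx orbT.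
Qed.

Definition max_metric : metric_on R (T * M)%type :=
  MetricOn max_distxx max_dist_eq0 max_dist_sym max_dist_triangle.

Lemma nbhs_metrizedP (S : topologicalType) (c : metric_on R S) :
  induces_topology c -> forall (x : S) (A : set S),
  nbhs x A <-> exists2 e : R, 0 < e & [set y | c x y < e] `<=` A.
Proof.
move=> hc x A.
have -> : nbhs x A <-> @nbhs _ (metrized c) x A.
  rewrite nbhsE (@nbhsE (metrized c)); split=> -[U [oU Ux] UA];
    by exists U => //; split=> //; apply/hc.
rewrite -(@nbhs_ballE R (metrized c)); split=> -[e /= e0 eA]; by exists e.
Qed.

Lemma max_metric_induces : induces_topology d -> induces_topology max_metric.
Proof.
move=> hd A; rewrite !openE.
suff h (p : T * M) : nbhs p A <-> @nbhs _ (metrized max_metric) p A.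
  by split=> hA p /hA /h.
rewrite -(@nbhs_ballE R (metrized max_metric)); split.
- move=> [[U V] /= [Up Vp] UV].
  have [e e0 eU] := (nbhs_metrizedP hd _ _).1 Up.
  move: Vp; rewrite -nbhs_ballE => -[e' /= e'0 eV].
  exists (Num.min e e'); first by rewrite /= lt_min e0.
  move=> q; rewrite ballEmdist /= /mdist /= /max_dist.
  rewrite gt_max !lt_min => /andP[/andP[h1 _] /andP[_ h2]].
  by apply: UV; split=> /=; [apply: eU | apply: eV; rewrite ballEmdist].
- move=> [e /= e0 eA].
  exists ([set y | d p.1 y < e], ball p.2 e).
    split=> /=; last exact: nbhsx_ballx.
    by apply/(nbhs_metrizedP hd); exists e.
  move=> [b y] /= [h1]; rewrite ballEmdist /= => h2.
  by apply: eA; rewrite ballEmdist /= /mdist /= /max_dist /= gt_max h1.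
Qed.

End MaxMetric.

Lemma max_metric_isometric (R : realType) (tau : structure R)
  (m : metrization tau) (X Y : bcm R) (f : isometric_embedding X Y)
  (p q : tau X * X) :
  max_metric Y (m Y) (st_map_prod f p) (st_map_prod f q) =
  max_metric X (m X) p q.
Proof. by rewrite /= /max_dist /= mz_isometric iembP. Qed.

Definition erm_of_metrization (R : realType) (tau : structure R)
    (m : metrization tau) : er_metrization tau :=
  @ErMetrization R tau (fun X => max_metric X (m X))
    (fun X => max_metric_induces (@mz_induces R tau m X))
    (@max_metric_isometric R tau m).

Definition thickening (R : realType) (M : metricType R) (A : set M) (e : R) :
  set M := [set x | exists2 y, A y & mdist x y <= e].

Definition hausdorff_dist (R : realType) (M : metricType R) (A B : set M) :
    \bar R :=
  ereal_inf [set e%:E | e in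
    [set e : R | [/\ 0 <= e, A `<=` thickening B e & B `<=` thickening A e]]].

Definition dF (R : realType) (M : metricType R) (A : set M) (x : M)
    (B : set M) (y : M) : \bar R :=
  maxe (mdist x y)%:E
    (\int[@lebesgue_measure R]_(r in `[0%R, +oo[)
      ((expR (- r))%:E *
       mine 1 (hausdorff_dist (A `&` cball x r) (B `&` cball y r))))%E.

Record marked_bcm (R : realType) (tau : structure R) := MarkedBcm {
  marked_space :> rooted_bcm R;
  marked_elt : tau marked_space
}.

Definition marked_equiv (R : realType) (tau : structure R)
    (X Y : marked_bcm tau) : Prop :=
  exists f : isometric_embedding X Y,
    [/\ bijective f, f (root_pt X) = root_pt Y &
        st_map tau f (marked_elt X) = marked_elt Y].

Lemma iemb_eq (R : realType) (A B : metricType R)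
  (f g : isometric_embedding A B) : f =1 g -> f = g.
Proof.
case: f g => [f hf] [g hg] /= /funext fg; rewrite fg in hf *.
by congr IsoEmb; exact: Prop_irrelevance.
Qed.

Lemma marked_equiv_refl (R : realType) (tau : structure R)
  (X : marked_bcm tau) : marked_equiv X X.
Proof. by exists (iemb_id _); split; [exists id | | exact: st_map_id]. Qed.

Lemma marked_equiv_sym (R : realType) (tau : structure R)
  (X Y : marked_bcm tau) : marked_equiv X Y -> marked_equiv Y X.
Proof.
case=> f [[g fK gK] fr fa].
have hg x y : mdist (g x) (g y) = mdist x y by rewrite -(iembP f) !gK.
exists (IsoEmb hg); split; first by exists f.
- by rewrite -fr /= fK.
- rewrite -fa -st_map_comp -[RHS]st_map_id; congr st_map.
  by apply: iemb_eq => x /=; rewrite fK.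
Qed.

Lemma marked_equiv_trans (R : realType) (tau : structure R)
  (X Y Z : marked_bcm tau) :
  marked_equiv X Y -> marked_equiv Y Z -> marked_equiv X Z.
Proof.
case=> f [fb fr fa] [g [gb gr ga]].
exists (iemb_comp g f); split; first exact: bij_comp.
- by rewrite /= fr.
- by rewrite st_map_comp fa.
Qed.

(* An equivalence class, as a predicate: marked_bcm lives in a universe too
   large for a choiceType, so {eq_quot _} does not apply. *)
Record marked_class (R : realType) (tau : structure R) := MarkedClass {
  in_class :> marked_bcm tau -> Prop;
  is_class : exists X, forall Y, in_class Y <-> marked_equiv X Y
}.

Definition class_of (R : realType) (tau : structure R) (X : marked_bcm tau) :
    marked_class tau :=
  @MarkedClass R tau (marked_equiv X) (ex_intro _ X (fun=> iff_refl _)).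

Definition repr (R : realType) (tau : structure R) (C : marked_class tau) :
    marked_bcm tau :=
  sval (cid (is_class C)).

Lemma in_classE (R : realType) (tau : structure R) (C : marked_class tau)
  (X : marked_bcm tau) : C X <-> marked_equiv (repr C) X.
Proof. by rewrite /repr; case: cid => Y /= /(_ X). Qed.

Lemma marked_class_eq (R : realType) (tau : structure R)
  (C D : marked_class tau) : (forall X, C X <-> D X) -> C = D.
Proof.
case: C D => [c hc] [d hd] /= cd.
have {}cd : c = d by apply/funext => X; apply/propext.
by move: hc; rewrite cd => hc; rewrite (Prop_irrelevance hc hd).
Qed.

Lemma reprK (R : realType) (tau : structure R) (C : marked_class tau) :
  class_of (repr C) = C.
Proof. by apply: marked_class_eq => X; apply: iff_sym; exact: in_classE. Qed.

Lemma class_ofP (R : realType) (tau : structure R) (X Y : marked_bcm tau) :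
  class_of X = class_of Y <-> marked_equiv X Y.
Proof.
split=> [XY|XY]; last apply: marked_class_eq => Z /=.
  have : class_of X Y by rewrite XY; exact: marked_equiv_refl.
  by [].
split; last exact: marked_equiv_trans.
by apply: marked_equiv_trans; exact: marked_equiv_sym.
Qed.

Definition erm_values (R : realType) (tau : structure R)
    (e : er_metrization tau) (X Y : marked_bcm tau) : set (\bar R) :=
  [set v | exists (Z : bcm R) (f : isometric_embedding X Z)
      (g : isometric_embedding Y Z),
    v = maxe
      (dF (range f) (f (root_pt X)) (range g) (g (root_pt Y)))
      (e Z (st_map tau f (marked_elt X), f (root_pt X))
           (st_map tau g (marked_elt Y), g (root_pt Y)))%:E].

Definition rooted_erm_values (R : realType) (tau : structure R)
    (e : er_metrization tau) (X Y : marked_bcm tau) : set (\bar R) :=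
  [set v | exists (Z : rooted_bcm R) (f : isometric_embedding X Z)
      (g : isometric_embedding Y Z),
    [/\ f (root_pt X) = root_pt Z, g (root_pt Y) = root_pt Z &
    v = maxe
      (dF (range f) (root_pt Z) (range g) (root_pt Z))
      (e Z (st_map tau f (marked_elt X), root_pt Z)
           (st_map tau g (marked_elt Y), root_pt Z))%:E]].

(* Distances are kept in \bar R, so that an infimum over an empty set would be
   +oo. *)
Definition dcheck_erm (R : realType) (tau : structure R)
    (e : er_metrization tau) (cX cY : marked_class tau) : \bar R :=
  ereal_inf (erm_values e (repr cX) (repr cY)).

Definition d_erm (R : realType) (tau : structure R)
    (e : er_metrization tau) (cX cY : marked_class tau) : \bar R :=
  ereal_inf (rooted_erm_values e (repr cX) (repr cY)).

Lemma repr_class_of (R : realType) (tau : structure R)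
  (X : marked_bcm tau) : marked_equiv (repr (class_of X)) X.
Proof. by apply/in_classE; exact: marked_equiv_refl. Qed.

Lemma range_bij (A B C : Type) (f : B -> C) (h : A -> B) :
  bijective h -> range (f \o h) = range f.
Proof.
case=> k _ kK; apply/seteqP; split=> [_ [x _ <-]|_ [y _ <-]].
- by exists (h x).
- by exists (k y) => //=; rewrite kK.
Qed.

Lemma erm_values_equiv (R : realType) (tau : structure R)
  (e : er_metrization tau) (X X' Y Y' : marked_bcm tau) :
  marked_equiv X X' -> marked_equiv Y Y' ->
  erm_values e X' Y' `<=` erm_values e X Y.
Proof.
move=> [p [pb pr pa]] [q [qb qr qa]] v [Z [f [g ->]]].
exists Z, (iemb_comp f p), (iemb_comp g q).
by rewrite !st_map_comp pa qa /= pr qr !range_bij.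
Qed.

Lemma rooted_erm_values_equiv (R : realType) (tau : structure R)
  (e : er_metrization tau) (X X' Y Y' : marked_bcm tau) :
  marked_equiv X X' -> marked_equiv Y Y' ->
  rooted_erm_values e X' Y' `<=` rooted_erm_values e X Y.
Proof.
move=> [p [pb pr pa]] [q [qb qr qa]] v [Z [f [g [fr gr ->]]]].
exists Z, (iemb_comp f p), (iemb_comp g q).
by rewrite !st_map_comp pa qa /= pr qr !range_bij.
Qed.

Lemma dcheck_ermE (R : realType) (tau : structure R)
  (e : er_metrization tau) (X Y : marked_bcm tau) :
  dcheck_erm e (class_of X) (class_of Y) = ereal_inf (erm_values e X Y).
Proof.
have hX := repr_class_of X; have hY := repr_class_of Y.
congr ereal_inf; apply/seteqP; split; apply: erm_values_equiv => //;
  exact: marked_equiv_sym.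
Qed.

Lemma d_ermE (R : realType) (tau : structure R)
  (e : er_metrization tau) (X Y : marked_bcm tau) :
  d_erm e (class_of X) (class_of Y) = ereal_inf (rooted_erm_values e X Y).
Proof.
have hX := repr_class_of X; have hY := repr_class_of Y.
congr ereal_inf; apply/seteqP; split; apply: rooted_erm_values_equiv => //;
  exact: marked_equiv_sym.
Qed.

Definition dcheck_m (R : realType) (tau : structure R) (m : metrization tau)
    (cX cY : marked_class tau) : \bar R :=
  dcheck_erm (erm_of_metrization m) cX cY.

Definition d_m (R : realType) (tau : structure R) (m : metrization tau)
    (cX cY : marked_class tau) : \bar R :=
  d_erm (erm_of_metrization m) cX cY.

(* Main.v *)
(** Given isometric embeddings [f : X -> Z] and [g : Y -> Z] whose roots are at
    distance [e], glue [X] and [Y] at their roots by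
    [d' x y = min (d (f x) (g y) + e) (d x rho_X + d rho_Y y)].  Then
    [d' x y <= d (f x) (g y) + e], so that passing from [Z] to the gluing raises [dF]
    by at most [e] (both Hausdorff distances under the integral compare the same
    subsets of [X] and [Y]) and the other term by at most [Theta s], for every
    [s >= e] by stability.  Since [Theta] need not be monotone, [s] is taken to
    be exactly twice the unrooted distance when that distance is positive; when
    it is zero one uses the limit of [Theta] at 0. *)

Require Import Defs.
From HB Require Import structures.
From mathcomp Require Import all_boot all_order all_algebra.
From mathcomp Require Import all_classical all_reals all_analysis.
From mathcomp Require Import measurable_realfun lra.

Set Implicit Arguments.
Unset Strict Implicit.
Unset Printing Implicit Defensive.

Import Order.TTheory GRing.Theory Num.Theory.
Import numFieldNormedType.Exports.

Local Open Scope ring_scope.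
Local Open Scope classical_set_scope.
Local Open Scope quotient_scope.

(** * Integrals of nonnegative functions that may fail to be measurable *)

Section LowerIntegral.
Local Open Scope ereal_scope.
Context d (T : measurableType d) (R : realType).
Variable mu : {measure set T -> \bar R}.
Import HBNNSimple.

(** Both sides are suprema over simple functions, and a simple function below [f] is below [g]. This
    serves the integrand of [dF], whose measurability in [r] is not established. *)
Lemma ge0_le_integral_nonmeasurable (D : set T) (f g : T -> \bar R) :
  (forall x, D x -> 0 <= f x) -> (forall x, D x -> f x <= g x) ->
  \int[mu]_(x in D) f x <= \int[mu]_(x in D) g x.
Proof.
move=> f0 fg; rewrite !ge0_integralE//; last first.
  by move=> x Dx; exact: le_trans (f0 _ Dx) (fg _ Dx).
apply: ereal_sup_le => _ [h hf <-].
exists h => // x; apply: le_trans (hf x) _.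
exact: lee_restrict.
Qed.

(* The integral of a non-measurable function [f] is a supremum over the simple
   functions below [f]; a simple function [h <= f + c] satisfies
   [max (h - c) 0 <= f], whose left-hand side is measurable. *)
Lemma ge0_integralD_nonmeasurable (D : set T) (f : T -> \bar R) (c : T -> R) :
  measurable D -> (forall x, D x -> 0 <= f x) ->
  (forall x, D x -> (0 <= c x)%R) -> measurable_fun D c ->
  \int[mu]_(x in D) (f x + (c x)%:E) <=
  \int[mu]_(x in D) f x + \int[mu]_(x in D) (c x)%:E.
Proof.
move=> mD f0 c0 mc; rewrite [leLHS]ge0_integralE; last first.
  by move=> x Dx; rewrite adde_ge0// ?f0// lee_fin c0.
apply: ge_ereal_sup => _ [h hfc <-].
(* [h] lies below a function extended by zero, so it vanishes outside [D]. *)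
have hD : sintegral mu h = \int[mu]_(x in D) (h x)%:E.
  rewrite integral_nnsfun//; apply: eq_sintegral => x.
  rewrite patchE; case: ifPn => // xD; apply/eqP; rewrite eq_le fun_ge0 andbT.
  by have := hfc x; rewrite patchE (negbTE xD) lee_fin.
pose k x := Num.max (h x - c x)%R 0%R.
have mh : measurable_fun D h by exact: measurable_funTS.
have mk : measurable_fun D k.
  by apply: measurable_maxr => //; apply: measurable_funB.
rewrite hD; apply: (@le_trans _ _ (\int[mu]_(x in D) ((k x)%:E + (c x)%:E))).
  apply: ge0_le_integral_nonmeasurable => x Dx; rewrite lee_fin//.
  by rewrite -lerBlDr le_max lexx.
rewrite ge0_integralD//; last 3 first.
- by move=> x _; rewrite lee_fin le_max lexx orbT.
- exact/measurable_EFinP.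
- exact/measurable_EFinP.
apply: leeD => //; apply: ge0_le_integral_nonmeasurable => x Dx.
  by rewrite lee_fin le_max lexx orbT.
have := hfc x; rewrite patchE mem_set// /k EFin_max ge_max f0// andbT.
by rewrite EFinB leeBlDr.
Qed.

End LowerIntegral.

(** * Stability of the Hausdorff distance and of [dF] under a change of ambient space *)

Section HausdorffStability.
Context (R : realType) (X Y M1 M2 : metricType R).
Context (f1 : isometric_embedding X M1) (f2 : isometric_embedding X M2).
Context (g1 : isometric_embedding Y M1) (g2 : isometric_embedding Y M2).
Variable e : R.
Hypothesis e0 : 0 <= e.
Hypothesis fg : forall x y, mdist (f2 x) (g2 y) <= mdist (f1 x) (g1 y) + e.

(** Hence the sets compared in [dF] are images of balls of the embedded space, which do not depend
    on the ambient space. *)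
Lemma range_cball (A B : metricType R) (f : isometric_embedding A B) x r :
  range f `&` cball (f x) r = f @` cball x r.
Proof.
apply/seteqP; split=> [_ [[y _ <-]]|_ [y xy <-]]; rewrite /cball /= iembP.
  by move=> xy; exists y.
by split=> //; exists y.
Qed.

Lemma hausdorff_dist_ge0 (M : metricType R) (A B : set M) :
  (0 <= hausdorff_dist A B)%E.
Proof. by apply: le_ereal_inf_tmp => _ [r [r0 _ _] <-]; rewrite lee_fin. Qed.

(** If [r] is admissible in [M1], then [r + e] is admissible in [M2], with the same pairs of points
    of [X] and [Y] as witnesses. *)
Lemma hausdorff_dist_stable (A : set X) (B : set Y) :
  (hausdorff_dist (f2 @` A) (g2 @` B) <=
   hausdorff_dist (f1 @` A) (g1 @` B) + e%:E)%E.
Proof.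
rewrite -leeBlDr//; apply: le_ereal_inf_tmp => _ [r [r0 AB BA] <-].
rewrite leeBlDr// -EFinD; apply: ereal_inf_lbound.
exists (r + e) => //; split; first exact: addr_ge0.
- move=> _ [x Ax <-]; have [|_ [y By <-] xy] := AB (f1 x); first by exists x.
  by exists (g2 y); [exists y|rewrite (le_trans (fg x y))// lerD2r].
- move=> _ [y By <-]; have [|_ [x Ax <-] yx] := BA (g1 y); first by exists y.
  exists (f2 x); first by exists x.
  by rewrite metric_sym (le_trans (fg x y))// lerD2r metric_sym.
Qed.

(** The total mass of the exponential distribution of rate 1. *)
Lemma integral_expRN :
  (\int[@lebesgue_measure R]_(r in `[0%R, +oo[) (expR (- r))%:E = 1)%E.
Proof.
rewrite -(@integral_exponential_pdf R 1)// [LHS]integral_mkcond.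
apply: eq_integral => x _; rewrite /exponential_pdf !patchE.
by case: ifP => // _; rewrite mul1r mulN1r.
Qed.

(** Truncation at 1 preserves the bound on the Hausdorff distances, so the integrand grows by at
    most [e * expR (- r)], which integrates to [e]. *)
Lemma dF_stable (x : X) (y : Y) :
  (dF (range f2) (f2 x) (range g2) (g2 y) <=
   dF (range f1) (f1 x) (range g1) (g1 y) + e%:E)%E.
Proof.
rewrite /dF ge_max; apply/andP; split.
  apply: (@le_trans _ _ ((mdist (f1 x) (g1 y))%:E + e%:E)%E).
    by rewrite -EFinD lee_fin fg.
  by rewrite leeD2r// le_max lexx.
apply: (@le_trans _ _ (\int[@lebesgue_measure R]_(r in `[0%R, +oo[)
      ((expR (- r))%:E * mine 1 (hausdorff_dist (range f1 `&` cball (f1 x) r)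
        (range g1 `&` cball (g1 y) r)) + (e * expR (- r))%:E))%E).
  apply: ge0_le_integral_nonmeasurable => r _.
    by rewrite mule_ge0 ?lee_fin ?expR_ge0// le_min lee01 hausdorff_dist_ge0.
  rewrite mulrC EFinM -ge0_muleDr ?lee_fin//; last first.
    by rewrite le_min lee01 hausdorff_dist_ge0.
  apply: lee_wpmul2l; first by rewrite lee_fin expR_ge0.
  rewrite !range_cball.
  have := hausdorff_dist_stable (cball x r) (cball y r).
  move: (hausdorff_dist _ _) (hausdorff_dist _ _) => a b ba.
  rewrite {2}/mine; case: ifPn => _.
    by rewrite ge_min leeDl ?lee_fin.
  by rewrite ge_min ba orbT.
have mE : measurable_fun (`[0%R, +oo[ : set R) (fun r : R => expR (- r)).
  by apply: measurable_funTS; exact: measurableT_comp.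
apply: le_trans.
  apply: ge0_integralD_nonmeasurable => //.
  - move=> r _.
    by rewrite mule_ge0 ?lee_fin ?expR_ge0// le_min lee01 hausdorff_dist_ge0.
  - by move=> r _; rewrite mulr_ge0 ?expR_ge0.
  - exact: measurable_funM.
apply: leeD; first by rewrite le_max lexx orbT.
under eq_integral do rewrite EFinM.
rewrite ge0_integralZl//; last exact/measurable_EFinP.
by rewrite integral_expRN mule1.
Qed.

End HausdorffStability.

(** * The metric quotient of a pseudometric *)

Record pseudometric (R : realType) (T : Type) := Pseudometric {
  pm_fun :> T -> T -> R;
  pm_xx : forall x, pm_fun x x = 0;
  pm_sym : forall x y, pm_fun x y = pm_fun y x;
  pm_triangle : forall y x z, pm_fun x z <= pm_fun x y + pm_fun y z
}.

Section PseudometricQuotient.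
Context (R : realType) (T : choiceType) (d : pseudometric R T).

Definition pm_rel : rel T := fun x y => d x y == 0.

Lemma pm_ge0 x y : 0 <= d x y.
Proof. by have := pm_triangle d y x x; rewrite pm_xx (pm_sym d y x); lra. Qed.

Lemma pm_rel_refl : reflexive pm_rel.
Proof. by move=> x; rewrite /pm_rel pm_xx. Qed.

Lemma pm_rel_sym : symmetric pm_rel.
Proof. by move=> x y; rewrite /pm_rel pm_sym. Qed.

Lemma pm_rel_trans : transitive pm_rel.
Proof.
move=> y x z /eqP xy /eqP yz; rewrite /pm_rel eq_le pm_ge0 andbT.
by have := pm_triangle d y x z; rewrite xy yz addr0.
Qed.

Canonical pm_equiv := EquivRel pm_rel pm_rel_refl pm_rel_sym pm_rel_trans.

Definition pm_quotient := {eq_quot pm_equiv}.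
HB.instance Definition _ := Choice.on pm_quotient.
HB.instance Definition _ := Quotient.on pm_quotient.

Definition pm_dist (p q : pm_quotient) : R :=
  d (repr p) (repr q).

(** A point is at distance 0 from the chosen representative of its class, so by the triangle
    inequality the choice does not matter. *)
Lemma pm_dist_pi x y : pm_dist (\pi x) (\pi y) = d x y.
Proof.
have h z : d z (repr (\pi_pm_quotient z)) = 0.
  apply/eqP; have : z = repr (\pi_pm_quotient z) %[mod pm_quotient].
    by rewrite reprK.
  by move/eqquotP.
rewrite /pm_dist; apply/eqP; rewrite eq_le; apply/andP; split.
- apply: le_trans (pm_triangle d x _ _) _; rewrite pm_sym h add0r.
  by apply: le_trans (pm_triangle d y _ _) _; rewrite h addr0.
- apply: le_trans (pm_triangle d (repr (\pi_pm_quotient x)) _ _) _.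
  rewrite h add0r.
  apply: le_trans (pm_triangle d (repr (\pi_pm_quotient y)) _ _) _.
  by rewrite (pm_sym d _ y) h addr0.
Qed.

Lemma pm_dist_eq0 p q : pm_dist p q = 0 -> p = q.
Proof.
move=> /eqP pq; rewrite -[p]reprK -[q]reprK.
exact/eqquotP.
Qed.

HB.instance Definition _ := @isMetric.Build R pm_quotient pm_dist
  (fun p => pm_xx d _) pm_dist_eq0 (fun p q => pm_sym d _ _)
  (fun p q r => pm_triangle d _ _ _).

Lemma mdist_pi x y : mdist (\pi_pm_quotient x) (\pi_pm_quotient y) = d x y.
Proof. exact: pm_dist_pi. Qed.

End PseudometricQuotient.

(** * Continuity of isometric embeddings and closedness of balls *)

Lemma continuous_iemb (R : realType) (A B : metricType R)
  (f : isometric_embedding A B) : continuous f.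
Proof.
move=> x; apply/metricType_numDomainType.cvgrPdist_lt => e e0.
near=> y; rewrite iembP.
near: y; exact: (@metricType_numDomainType.cvgr_dist_lt R A _ (nbhs x) _ id).
Unshelve. all: by end_near. Qed.

Lemma closed_cball (R : realType) (M : metricType R) (x : M) (r : R) :
  closed (cball x r).
Proof.
rewrite -[cball x r]setCK; apply: open_closedC; rewrite openE => y.
rewrite /cball /= => /negP; rewrite -ltNge => ry.
apply/metricType_numDomainType.nbhs_mdistP; exists (mdist x y - r).
  by rewrite /= subr_gt0.
move=> z /= yz; apply/negP; rewrite -ltNge.
by have := metric_triangle x z y; rewrite (metric_sym z y); lra.
Qed.

(** * Gluing two rooted spaces at their roots *)

Section RootGluing.
Context (R : realType) (X Y : rooted_bcm R) (Z : bcm R).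
Context (f : isometric_embedding X Z) (g : isometric_embedding Y Z).

Let x0 := root_pt X.
Let y0 := root_pt Y.
Let e := mdist (f x0) (g y0).

(** The first term gives the upper bound wanted in [root_gluing]; the second, the length of a path
    through the common root, puts the roots at distance 0. *)
Definition cross_dist (x : X) (y : Y) : R :=
  Num.min (mdist (f x) (g y) + e) (mdist x x0 + mdist y0 y).

Definition glue_dist (p q : X + Y) : R :=
  match p, q with
  | inl x, inl x' => mdist x x'
  | inl x, inr y => cross_dist x y
  | inr y, inl x => cross_dist x y
  | inr y, inr y' => mdist y y'
  end.

Lemma glue_distxx p : glue_dist p p = 0.
Proof. by case: p => z; exact: mdistxx. Qed.

Lemma glue_dist_sym p q : glue_dist p q = glue_dist q p.
Proof. by case: p q => [x|y] [x'|y'] //=; rewrite metric_sym. Qed.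

Lemma cross_dist_trianglel x x' y :
  cross_dist x y <= mdist x x' + cross_dist x' y.
Proof.
rewrite /cross_dist; have := metric_triangle (f x) (f x') (g y).
have := metric_triangle x x' x0; rewrite iembP => h1 h2.
by rewrite /Num.min; do 2 case: ifPn; rewrite -?leNgt; lra.
Qed.

Lemma cross_dist_triangler x y y' :
  cross_dist x y <= cross_dist x y' + mdist y' y.
Proof.
rewrite /cross_dist; have := metric_triangle (f x) (g y') (g y).
have := metric_triangle y0 y' y; rewrite iembP => h1 h2.
by rewrite /Num.min; do 2 case: ifPn; rewrite -?leNgt; lra.
Qed.

(** The summand [e] of [cross_dist] pays for the mixed case, where one minimum is the first term and
    the other the second: [d x x0] is bounded by going from [f x] through [g y] and [g y0] to
    [f x0], whose last leg has length [e]. *)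
Lemma mdist_le_crossl x x' y : mdist x x' <= cross_dist x y + cross_dist x' y.
Proof.
have h1 := metric_triangle x x0 x'; have h2 := metric_triangle (f x) (g y) (f x').
have h3 := metric_triangle (f x) (g y) (f x0).
have h4 := metric_triangle (f x') (g y) (f x0).
have h5 := metric_triangle (g y) (g y0) (f x0).
have h6 := mdist_ge0 y0 y; have e0 : 0 <= e := mdist_ge0 _ _.
move: h2 h3 h4 h5; rewrite (metric_sym (g y) (f x')) !iembP.
rewrite (metric_sym (g y0) (f x0)) -/e (metric_sym y y0) => h2 h3 h4 h5.
rewrite (metric_sym x0 x') in h1; rewrite /cross_dist.
by rewrite /Num.min; do 2 case: ifPn; rewrite -?leNgt; lra.
Qed.

Lemma mdist_le_crossr x y y' : mdist y y' <= cross_dist x y + cross_dist x y'.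
Proof.
have h1 := metric_triangle y y0 y'; have h2 := metric_triangle (g y) (f x) (g y').
have h3 := metric_triangle (g y) (f x) (g y0).
have h4 := metric_triangle (g y') (f x) (g y0).
have h5 := metric_triangle (f x) (f x0) (g y0).
have h6 := mdist_ge0 x x0; have e0 : 0 <= e := mdist_ge0 _ _.
move: h2 h3 h4 h5; rewrite (metric_sym (g y) (f x)) (metric_sym (g y') (f x)).
rewrite !iembP -/e (metric_sym y y0) (metric_sym y' y0) => h2 h3 h4 h5.
rewrite (metric_sym y y0) in h1; rewrite /cross_dist.
by rewrite /Num.min; do 2 case: ifPn; rewrite -?leNgt; lra.
Qed.

Lemma glue_dist_triangle q p r :
  glue_dist p r <= glue_dist p q + glue_dist q r.
Proof.
case: p q r => [x|y] [x'|y'] [x''|y''] /=.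
- exact: metric_triangle.
- exact: cross_dist_trianglel.
- exact: mdist_le_crossl.
- exact: cross_dist_triangler.
- by rewrite addrC metric_sym cross_dist_trianglel.
- exact: mdist_le_crossr.
- by rewrite addrC metric_sym cross_dist_triangler.
- exact: metric_triangle.
Qed.

Definition glue_pm : pseudometric R (X + Y)%type :=
  Pseudometric glue_distxx glue_dist_sym glue_dist_triangle.

(** Besides the roots, a quotient is needed for all [x] and [y] with [f x = g y] when [e = 0]: they
    too are at distance 0. *)
Definition glued : metricType R := pm_quotient glue_pm.

Definition glue_inl : isometric_embedding X glued :=
  @IsoEmb R X glued (fun x => \pi_(pm_quotient glue_pm) (inl x))
    (fun x x' => mdist_pi glue_pm (inl x) (inl x')).

Definition glue_inr : isometric_embedding Y glued :=
  @IsoEmb R Y glued (fun y => \pi_(pm_quotient glue_pm) (inr y))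
    (fun y y' => mdist_pi glue_pm (inr y) (inr y')).

Lemma glue_cross x y : mdist (glue_inl x) (glue_inr y) = cross_dist x y.
Proof. exact: (mdist_pi glue_pm (inl x) (inr y)). Qed.

Lemma glue_root : glue_inr y0 = glue_inl x0.
Proof.
apply/esym/mdist_positivity; rewrite glue_cross /cross_dist !mdistxx addr0.
by apply/min_idPr; rewrite addr_ge0// mdist_ge0.
Qed.

(** By the triangle inequality the ball lies in the ball of radius [s] about the common root, which
    is covered by the images of two compact balls. *)
Lemma glued_compact (p : glued) (r : R) : compact (cball p r).
Proof.
pose s := mdist (glue_inl x0) p + r.
apply: (@subclosed_compact _ _ (glue_inl @` cball x0 s `|`
                                glue_inr @` cball y0 s)).
- exact: closed_cball.
- apply: compactU; apply: continuous_compact; try exact: bcm_compact.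
    by apply: continuous_subspaceT; exact: continuous_iemb.
  by apply: continuous_subspaceT; exact: continuous_iemb.
- move=> q pq.
  have : mdist (glue_inl x0) q <= s.
    by apply: le_trans (metric_triangle _ p _) _; rewrite lerD2l.
  rewrite -[q]reprK.
  case: (repr q) => [x|y] hs.
    by left; exists x => //; rewrite /cball /= -(iembP glue_inl).
  by right; exists y => //; rewrite /cball /= -(iembP glue_inr) glue_root.
Qed.

Definition glued_bcm : rooted_bcm R :=
  @RootedBcm R (@Bcm R glued (ex_intro _ (glue_inl x0) Logic.I) glued_compact)
    (glue_inl x0).

Lemma root_gluing :
  exists (W : rooted_bcm R) (f' : isometric_embedding X W)
      (g' : isometric_embedding Y W),
    [/\ f' (root_pt X) = root_pt W, g' (root_pt Y) = root_pt W &
      forall x y, mdist (f' x) (g' y) <=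
        mdist (f x) (g y) + mdist (f (root_pt X)) (g (root_pt Y))].
Proof.
exists glued_bcm, glue_inl, glue_inr; split => //; first exact: glue_root.
by move=> x y; rewrite glue_cross ge_min lexx.
Qed.

End RootGluing.

(* The stability estimate restricted to pairs [(a, x)], [(b, y)] whose points
   [x] and [y] are identified by the second pair of embeddings; it holds with
   the distortion of [m] itself for the [er_metrization] of a metrization [m]. *)
Definition root_stable (R : realType) (tau : structure R)
    (d : er_metrization tau) (Theta : R -> R) :=
  forall (X Y M1 M2 : bcm R)
    (f1 : isometric_embedding X M1) (f2 : isometric_embedding X M2)
    (g1 : isometric_embedding Y M1) (g2 : isometric_embedding Y M2)
    (e : R), 0 <= e ->
  (forall x y, mdist (f2 x) (g2 y) <= mdist (f1 x) (g1 y) + e) ->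
  forall a b x y, f2 x = g2 y ->
  d M2 (st_map tau f2 a, f2 x) (st_map tau g2 b, g2 y) <=
  d M1 (st_map tau f1 a, f1 x) (st_map tau g1 b, g1 y) + Theta e.

(** * Comparison of the rooted and unrooted distances *)

Section Comparison.
Context (R : realType) (tau : structure R) (d : er_metrization tau).
Context (Theta : R -> R).
Hypothesis Theta_ge0 : forall e, 0 <= e -> 0 <= Theta e.
Hypothesis Theta_lim : Theta e @[e --> 0^'+] --> (0 : R).
Hypothesis Theta0 : Theta 0 = 0.
Hypothesis d_stable : root_stable d Theta.

(** The rooted infimum runs over fewer values: a rooted configuration is also an unrooted one with
    the same value. *)
Lemma dcheck_le_d (X Y : marked_class tau) : (dcheck_erm d X Y <= d_erm d X Y)%E.
Proof.
apply: ereal_inf_le_tmp => v [Z [f [g [fr gr ->]]]].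
by exists Z, f, g; rewrite fr gr.
Qed.

Lemma dcheck_ge0 (X Y : marked_class tau) : (0 <= dcheck_erm d X Y)%E.
Proof.
apply: le_ereal_inf_tmp => v [Z [f [g ->]]].
by rewrite le_max lee_fin metric_fun_ge0 orbT.
Qed.

(** Some configuration has value below [v], and [dF] dominates the distance [e] of the roots, so
    [e <= v]. After gluing, [dF] is at most [v + e <= 2 * v] and the other term at most
    [v + Theta s]. *)
Lemma d_le_value (X Y : marked_class tau) (v s : R) :
  (dcheck_erm d X Y < v%:E)%E -> v <= s ->
  (d_erm d X Y <= (2 * v + Theta s)%:E)%E.
Proof.
move=> /ereal_inf_lt[_ [Z [f [g ->]]]].
rewrite gt_max => /andP[dFv dv] vs.
have [W [f' [g' [fr gr fg]]]] := root_gluing f g.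
set e := mdist (f _) (g _) in fg.
have e0 : 0 <= e := mdist_ge0 _ _.
have ev : e <= v.
  by rewrite -lee_fin; apply: le_trans _ (ltW dFv); rewrite /dF le_max lexx.
have s0 : 0 <= s by rewrite (le_trans e0)// (le_trans ev).
have fgs x y : mdist (f' x) (g' y) <= mdist (f x) (g y) + s.
  by rewrite (le_trans (fg x y))// lerD2l (le_trans ev).
apply: ge_ereal_inf; exists (maxe
   (dF (range f') (root_pt W) (range g') (root_pt W))
   (d W (st_map tau f' (marked_elt (Defs.repr X)), root_pt W)
        (st_map tau g' (marked_elt (Defs.repr Y)), root_pt W))%:E).
  by exists W, f', g'.
rewrite ge_max; apply/andP; split.
  rewrite -{1}fr -gr; apply: le_trans (dF_stable e0 fg _ _) _.
  apply: (@le_trans _ _ (v%:E + v%:E)%E); first by rewrite leeD ?lee_fin// ltW.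
  by rewrite -EFinD lee_fin; have := Theta_ge0 s0; lra.
rewrite lee_fin -{1}fr -gr; apply: le_trans (d_stable s0 fgs _ _ _) _.
  by rewrite fr gr.
by rewrite lte_fin in dv; lra.
Qed.

Lemma d_le_dcheck (X Y : marked_class tau) :
  (d_erm d X Y <= 2%:E * dcheck_erm d X Y +
     (Theta (2 * fine (dcheck_erm d X Y)))%:E)%E.
Proof.
have := dcheck_ge0 X Y; have := @d_le_value X Y.
(* At [+oo] the real-valued [Theta] term is finite, whatever [fine] returns, so the right-hand side
   is [+oo]. *)
case: (dcheck_erm d X Y) => [t| |] //= dle; last first.
  by move=> _; rewrite gt0_muley ?lte_fin// addye// leey.
rewrite lee_fin => t0; rewrite -EFinM -EFinD.
apply/lee_addgt0Pr => eta eta0; rewrite -EFinD.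
(* At distance zero take [v = s] so small that [2 * s] and [Theta s] are each below [eta / 2]. *)
move: t0; rewrite le_eqVlt => /predU1P[t0|t0].
  rewrite -t0 !mulr0 Theta0 !add0r.
  have eta2 : 0 < eta / 2 by rewrite divr_gt0.
  have hT : \forall s \near 0^'+, `|Theta s| < eta / 2.
    exact: (cvgr0Pnorm_lt _).1 Theta_lim _ eta2.
  have [s [s0 seta Ts]] : exists s,
      [/\ 0 < s, s < eta / 4 & `|Theta s| < eta / 2].
    near (0 : R)^'+ => s; exists s; split; near: s => //.
      by apply: nbhs_right_gt.
    by apply: nbhs_right_lt; rewrite divr_gt0.
  apply: le_trans (dle s s _ _) _ => //; first by rewrite -t0 lte_fin.
  by rewrite lee_fin; move/ltr_normlW : Ts; lra.
(* The first bound in the minimum allows exactly [s = 2 * t], the second gives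
   [2 * v <= 2 * t + eta]. *)
pose v := t + Num.min t (eta / 2).
have vt : v <= 2 * t by rewrite /v mulr_natl mulr2n lerD2l ge_min lexx.
have v_gt : t < v by rewrite ltrDl lt_min t0 divr_gt0.
apply: le_trans (dle v (2 * t) _ vt) _; first by rewrite lte_fin.
have : v <= t + eta / 2 by rewrite lerD2l ge_min lexx orbT.
by rewrite lee_fin; lra.
Unshelve. all: by end_near. Qed.

End Comparison.

(** * Both kinds of stable metrization satisfy [root_stable] *)

Lemma stable_root_stable (R : realType) (tau : structure R)
  (d : er_metrization tau) (Theta : R -> R) :
  stable (er_metrization_functor d) Theta -> root_stable d Theta.
Proof.
move=> [_ _ _ h] X Y M1 M2 f1 f2 g1 g2 e e0 fg a b x y _.
exact: (h X Y M1 M2 f1 f2 g1 g2 e e0 fg (a, x) (b, y)).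
Qed.

(** As [f2 x = g2 y], the point component of the maximum vanishes in [M2]. For other points it could
    grow by [e], which [Theta e] need not dominate. *)
Lemma metrization_root_stable (R : realType) (tau : structure R)
  (m : metrization tau) (Theta : R -> R) :
  stable (metrization_functor m) Theta ->
  root_stable (erm_of_metrization m) Theta.
Proof.
move=> [T0 _ _ h] X Y M1 M2 f1 f2 g1 g2 e e0 fg a b x y fxgy.
rewrite /= /max_dist /= fxgy mdistxx ge_max; apply/andP; split.
  apply: le_trans (h X Y M1 M2 f1 f2 g1 g2 e e0 fg a b) _.
  by rewrite lerD2r le_max lexx.
by rewrite addr_ge0 ?T0// le_max mdist_ge0 orbT.
Qed.

Local Close Scope quotient_scope.
Local Close Scope classical_set_scope.

Theorem theorem6p29 (R : realType) (tau : structure R)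
    (tau_cont : embedding_continuous tau) :
  (forall (e : er_metrization tau) (Theta : R -> R),
     stable (er_metrization_functor e) Theta ->
   forall X Y : marked_class tau,
     (dcheck_erm e X Y <= d_erm e X Y)%E /\
     (d_erm e X Y <= 2%:E * dcheck_erm e X Y +
        (Theta (2 * fine (dcheck_erm e X Y)))%:E)%E) /\
  (forall (m : metrization tau) (Theta : R -> R),
     stable (metrization_functor m) Theta ->
   forall X Y : marked_class tau,
     (dcheck_m m X Y <= d_m m X Y)%E /\
     (d_m m X Y <= 2%:E * dcheck_m m X Y +
        (Theta (2 * fine (dcheck_m m X Y)))%:E)%E).
Proof.
split=> [e|m] Theta sT X Y; (split; first exact: dcheck_le_d);
  have [T0 Tlim T00 _] := sT; apply: d_le_dcheck => //.
- exact: stable_root_stable.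
- exact: metrization_root_stable.
Qed.
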